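(* Let $L=K_1\cup K_2$ be a classical oriented 2-component link, with linking number $lk(L)$. Then its linking polynomial is the constant $L_{K_1\cup K_2}(t)=(lk(L))^2$.
   Context: The linking number is $lk(L)=\frac12\sum w(c)$ over the crossings $c$ between $K_1$ and $K_2$, where $w(c)\in\{\pm1\}$ is the sign of $c$. The linking polynomial is defined for any 2-component virtual link diagram $L=K_1\cup K_2$ (oriented, with classical and virtual crossings; a classical link is one with a diagram without virtual crossings) as follows; it is an invariant of virtual links. Gauss diagram of $L$: two oriented circles (the preimages of $K_1$ and $K_2$), with one signed arrow for each classical crossing $c$, directed from the preimage of the overcrossing (tail) to the preimage of the undercrossing (head), with sign $w(c)$. Let $r_\pm$ be the number of arrows of sign $\pm1$ directed from $K_1$ to $K_2$ and $l_\pm$ the number of arrows of sign $\pm1$ directed from $K_2$ to $K_1$; put $span(L)=|r_+-r_--l_++l_-|$ and $\mathbb{Z}_{span(L)}=\mathbb{Z}/span(L)\mathbb{Z}$ (equal to $\mathbb{Z}$ if $span(L)=0$). For classical $L$, $span(L)=0$. Let $l_1,l_2$ be the universal covers (oriented real lines) of the two circles, with all arrow endpoints (of self-crossings and non-self-crossings) lifted; they cut each $l_i$ into segments. Assign an arbitrary integer to one segment of $l_i$ and label the others by the rule: travelling along the orientation, passing the tail of an arrow of sign $\varepsilon$ changes the label by $+\varepsilon$, passing the head of an arrow of sign $\varepsilon$ changes it by $-\varepsilon$. The labelings of $l_1$ and $l_2$ are chosen independently. Labels are then reduced to classes in $\mathbb{Z}_{span(L)}$. For each arrow $c$ joining the two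 circles, choose lifts of its endpoints and let $N(c)\in\mathbb{Z}_{span(L)}$ be the label just before the head of $c$ minus the label just after the tail of $c$ (equivalently, just after the head minus just before the tail); this does not depend on the lifts. Define $F(t)=\sum w(c)t^{N(c)}$ over arrows directed from $l_1$ to $l_2$, $G(t)=\sum w(c)t^{N(c)}$ over arrows directed from $l_2$ to $l_1$, and $L_{K_1\cup K_2}(t)=F(t)G(t)$, which does not depend on the labelings. For $span(L)=0$ this is an element of $\mathbb{Z}[t,t^{-1}]$. *)

(* Defs.v *)
From HB Require Import structures.
From mathcomp Require Import all_boot all_order all_algebra.
From mathcomp Require Import generic_quotient ring_quotient.
From mathcomp Require Import finmap reals.
From mathcomp.multinomials Require Import monalg.
From mathcomp Require Import zify ring.

Set Implicit Arguments.
Unset Strict Implicit.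
Unset Printing Implicit Defensive.

Import Order.TTheory GRing.Theory Num.Theory.
Local Open Scope ring_scope.
Local Open Scope quotient_scope.

Definition multiples (n : nat) : zmodClosed int :=
  GRing.ZmodClosed.clone int (dvdz n) _.

(* Unlike ['Z_n], this is Z for n = 0 and the trivial group for n = 1. *)
Definition Zmod (n : nat) : zmodType := {ideal_quot (multiples n)}.

Definition Zmod_class (n : nat) (k : int) : Zmod n := \pi_({ideal_quot (multiples n)}) k.

(* [<< a *g k >>] is the term a t^k.  monalg has a product only when the
   exponents form a monoid without units other than its neutral element. *)
Definition gring_mul (A : zmodType) (f g : {malg int[A]}) : {malg int[A]} :=
  \sum_(a <- msupp f) \sum_(b <- msupp g) << f@_a * g@_b *g (a + b)%R >>.

Definition K1 : bool := false.
Definition K2 : bool := true.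

(* An endpoint of an arrow c is (c, true), its tail, or (c, false), its head;
   [circle i] lists the endpoints on the i-th circle in their cyclic order
   along the orientation, starting from an arbitrary base point. *)
Record gauss_diagram := GaussDiagram {
  arrow : finType;
  positive : pred arrow;
  circle : bool -> seq (arrow * bool);
  circleP : perm_eq (circle K1 ++ circle K2) (enum {: arrow * bool})
}.

Section Gauss.
Variable G : gauss_diagram.
Implicit Types (i j : bool) (c : arrow G) (e : arrow G * bool).

Definition tail_of c : arrow G * bool := (c, true).
Definition head_of c : arrow G * bool := (c, false).

Definition sign c : int := if positive c then 1 else -1.

Definition component e : bool := if e \in circle G K2 then K2 else K1.

Definition directed i j c : bool :=
  (component (tail_of c) == i) && (component (head_of c) == j).

Definition num_arrows i j (s : bool) : nat :=
  #|[pred c | directed i j c & positive c == s]|.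

Definition span : nat :=
  absz ((num_arrows K1 K2 true)%:Z - (num_arrows K1 K2 false)%:Z
     - (num_arrows K2 K1 true)%:Z + (num_arrows K2 K1 false)%:Z).

Definition linking_number : rat :=
  2^-1 * \sum_(c | component (tail_of c) != component (head_of c)) (sign c)%:~R.

(* The lifted endpoints on the universal cover of the i-th circle are numbered
   by the integers along the orientation: the k-th one lies over the entry of
   index k modulo [size (circle G i)]. *)
Definition lies_over i (k : int) e : bool :=
  onth (circle G i) (absz (k %% (size (circle G i))%:Z)%Z) == Some e.

Definition jump e : int := if e.2 then sign e.1 else - sign e.1.

(* [label i k] is the label of the segment ending at the k-th lifted endpoint,
   so [label i (k + 1)] is that of the segment starting there. *)
Record labeling := Labeling {
  label :> bool -> int -> int;
  labelP : forall i k e, lies_over i k e ->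
    label i (k + 1) = label i k + jump e
}.

Lemma labeling_exists (a : bool -> int) :
  exists lab : labeling, forall i, lab i 0 = a i.
Proof.
pose J i k := \sum_(e | lies_over i k e) jump e.
pose f i (k : int) := match k with
  | Posz n => a i + \sum_(m < n) J i m%:Z
  | Negz n => a i - \sum_(m < n.+1) J i (Negz m) end.
have fS i k : f i (k + 1) = f i k + J i k.
  case: k => [n|[|n]].
  - by rewrite -[_ + 1]/(Posz (n + 1)) addn1 /f big_ord_recr addrA.
  - by rewrite -[_ + 1]/(Posz 0) /f big_ord0 big_ord1 addr0 subrK.
  - have -> : Negz n.+1 + 1 = Negz n by rewrite !NegzE; lia.
    by rewrite /f [in RHS]big_ord_recr /= opprD addrA subrK.
have fP i k e : lies_over i k e -> f i (k + 1) = f i k + jump e.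
  move=> ke; rewrite fS /J (bigD1 e) //= big1 ?addr0 // => e' /andP[ke' ne].
  move: ke' ke ne; rewrite /lies_over => /eqP -> /eqP [->].
  by rewrite eqxx.
by exists (Labeling fP) => i; rewrite /= /f big_ord0 addr0.
Qed.

Record endpoint_lifts := EndpointLifts {
  lift_pos :> arrow G * bool -> int;
  lift_posP : forall e, lies_over (component e) (lift_pos e) e
}.

Lemma endpoint_lifts_exists : inhabited endpoint_lifts.
Proof.
have pP e : lies_over (component e) (index e (circle G (component e)))%:Z e.
  have eG : e \in circle G (component e).
    rewrite /component; case: ifP => // e2.
    have := perm_mem (circleP G) e; rewrite mem_cat mem_enum e2 orbF.
    by move=> ->.
  rewrite /lies_over modz_small /= ?ltz_nat ?index_mem //.
  by rewrite onthE (nth_map e) ?index_mem // nth_index.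
by constructor; exact: (EndpointLifts pP).
Qed.

Variables (lab : labeling) (p : endpoint_lifts).

Definition N c : Zmod span :=
  Zmod_class span
    (lab (component (head_of c)) (p (head_of c))
     - lab (component (tail_of c)) (p (tail_of c) + 1)).

Definition arrow_sum i j : {malg int[Zmod span]} :=
  \sum_(c | directed i j c) << sign c *g N c >>.

Definition linking_polynomial : {malg int[Zmod span]} :=
  gring_mul (arrow_sum K1 K2) (arrow_sum K2 K1).

End Gauss.

(* Diagrams are drawn with oriented closed polygons: component i has vertices
   [v i 0, ..., v i (nv i - 1)] and, in this order, the edges joining each
   vertex to the next, cyclically. *)
Section Polygons.
Variables (R : realType) (nv : bool -> nat) (v : forall i, 'I_(nv i) -> R * R).

Definition edge_of : finType := {i : bool & 'I_(nv i)}.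
Implicit Types a b c : edge_of.

Definition source a : R * R := v (tagged a).
Definition direction a : R * R := v (ordS (tagged a)) - v (tagged a).

Definition point_at a (s : R) : R * R :=
  ((source a).1 + s * (direction a).1, (source a).2 + s * (direction a).2).

Definition det2 (x y : R * R) : R := x.1 * y.2 - x.2 * y.1.

(* Every double point is a transverse crossing of the interiors of two edges,
   and there are no triple points.  With a = b this makes the edges
   nondegenerate, and with consecutive a, b it excludes backtracking. *)
Definition generic : Prop :=
  (forall a b (s t : R), 0 <= s < 1 -> 0 <= t < 1 -> (a, s) <> (b, t) ->
     point_at a s = point_at b t ->
     [/\ 0 < s, 0 < t & det2 (direction a) (direction b) <> 0]) /\
  (forall a b c (s t u : R), 0 <= s < 1 -> 0 <= t < 1 -> 0 <= u < 1 ->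
     (a, s) <> (b, t) -> (a, s) <> (c, u) -> (b, t) <> (c, u) ->
     point_at a s = point_at b t -> point_at a s <> point_at c u).

(* Cramer's rule: the s with point_at a s on the line carrying b. *)
Definition crossing_time a b : R :=
  det2 (source b - source a) (direction b) / det2 (direction a) (direction b).

Definition crosses a b : bool :=
  [&& det2 (direction a) (direction b) != 0,
      0 < crossing_time a b < 1 & 0 < crossing_time b a < 1].

Lemma crossesP a b : det2 (direction a) (direction b) <> 0 ->
  reflect (exists s t, [/\ 0 < s < 1, 0 < t < 1 & point_at a s = point_at b t])
          (crosses a b).
Proof.
rewrite /crosses /point_at /crossing_time.
case: (direction a) (direction b) => [x1 y1] [x2 y2].
case: (source a) (source b) => [x3 y3] [x4 y4]; rewrite /det2 /= => /eqP d0.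
have d1 : x2 * y1 - y2 * x1 != 0.
  by rewrite (_ : _ - _ = - (x1 * y2 - y1 * x2)) ?oppr_eq0 //; ring.
rewrite d0 /=; apply: (iffP idP) => [/andP[s01 t01]|].
  by do 2!eexists; split; [exact: s01 | exact: t01 |];
    congr (_, _); field; rewrite d0 d1.
move=> [s] [t] [s01 t01 [e1 e2]].
have -> : x4 = x3 + s * x1 - t * x2 by rewrite e1; ring.
have -> : y4 = y3 + s * y1 - t * y2 by rewrite e2; ring.
rewrite (_ : _ / _ = s); last by field.
by rewrite (_ : _ / (x2 * _ - _) = t) ?s01 //; field.
Qed.

End Polygons.

(* [(a, b) \in over] when the edges a and b cross classically, a passing over
   b; a crossing of a and b with neither (a, b) nor (b, a) in [over] is
   virtual. *)
Record virtual_diagram (R : realType) := VirtualDiagram {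
  nv : bool -> nat;
  vertex : forall i, 'I_(nv i) -> R * R;
  over : {set edge_of nv * edge_of nv};
  nv_gt2 : forall i, (2 < nv i)%N;
  vertex_generic : generic vertex;
  over_crosses : forall a b, (a, b) \in over -> crosses vertex a b;
  over_asym : forall a b, (a, b) \in over -> (b, a) \notin over
}.

Section GaussOfDiagram.
Variables (R : realType) (D : virtual_diagram R).

Definition edge : finType := edge_of (nv D).

Definition classical : Prop :=
  forall a b : edge, crosses (@vertex R D) a b ->
    (a, b) \in over D \/ (b, a) \in over D.

Definition classical_crossing : finType := {x : edge * edge | x \in over D}.

(* Counterclockwise rotation takes the over direction to the under direction
   at a positive crossing. *)
Definition crossing_positive (c : classical_crossing) : bool :=
  0 < det2 (direction (@vertex R D) (val c).1)
           (direction (@vertex R D) (val c).2).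

Implicit Type e : classical_crossing * bool.

Definition strand e : edge := if e.2 then (val e.1).1 else (val e.1).2.
Definition other_strand e : edge := if e.2 then (val e.1).2 else (val e.1).1.

Definition position e : R :=
  (tagged (strand e) : nat)%:R +
  crossing_time (@vertex R D) (strand e) (other_strand e).

Definition strand_circle (i : bool) : seq (classical_crossing * bool) :=
  sort (fun e f => position e <= position f)
       [seq e <- enum {: classical_crossing * bool} | tag (strand e) == i].

Lemma strand_circleP :
  perm_eq (strand_circle K1 ++ strand_circle K2)
          (enum {: classical_crossing * bool}).
Proof.
rewrite perm_sym -(perm_filterC (fun e => tag (strand e) == K1)) perm_sym.
by apply: perm_cat; rewrite perm_sort //; apply/permP => x; congr count;
  apply: eq_filter => e /=; case: (tag _).
Qed.

Definition gauss_of : gauss_diagram :=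
  @GaussDiagram classical_crossing crossing_positive strand_circle
    strand_circleP.

End GaussOfDiagram.

(* Main.v *)
Require Import Defs.
From HB Require Import structures.
From mathcomp Require Import all_boot all_order all_algebra.
From mathcomp Require Import finmap reals.
From mathcomp.multinomials Require Import monalg.
From mathcomp Require Import zify ring lra.

Set Implicit Arguments.
Unset Strict Implicit.
Unset Printing Implicit Defensive.

Import Order.TTheory GRing.Theory Num.Theory.
Local Open Scope ring_scope.

(* The jump at an arrow endpoint is the sign of det(its strand, the other
   strand), so labels behave like winding numbers: the sum of the two labels
   around an endpoint lying over the double point q, plus twice the mean winding
   number of the whole diagram about q, is a constant k_i of the circle K_i.  The
   two endpoints of an arrow c lie over the same point, whence
   2 N(c) = k_j - k_i for every arrow directed from K_i to K_j.  So F and G are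
   monomials with opposite exponents.  The jumps on one circle add up to 0, which
   makes the coefficients of F and G equal, hence both equal to lk.

   Winding numbers are counted by crossings of the horizontal axis, with the
   convention that a point on the polygon gets the mean of the values around it;
   how they change along an edge is computed from one edge of the diagram at a
   time. *)

(** * Turning of directions *)

Section Turn.
Variable R : realType.
Implicit Types (n u v w x y P Q D B : R * R) (r s t : R).

(* The ray of positive abscissas is included, so that exactly one of u and - u
   is upper when u <> 0. *)
Definition upper u : bool := (0 < u.2) || (u.2 == 0) && (0 < u.1).

(* The signed number of crossings of the horizontal axis by the short arc from
   direction u to direction v, or 0, the mean over both half turns, when u and v
   are opposite.  Around a closed polygon the turns add up to twice the winding
   number about 0. *)
Definition turn u v : int :=
  if upper u == upper v then 0 else sgz (det2 u v).

Definition scale r u : R * R := (r * u.1, r * u.2).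

Lemma turnC u v : turn v u = - turn u v.
Proof.
rewrite /turn eq_sym; case: ifP => _; rewrite ?oppr0 //.
by rewrite -sgzN; congr sgz; rewrite /det2; ring.
Qed.

Lemma turn_det0 u v : det2 u v = 0 -> turn u v = 0.
Proof. by rewrite /turn => ->; rewrite sgz0 if_same. Qed.

Lemma upperZ r u : 0 < r -> upper (scale r u) = upper u.
Proof.
by move=> r0; rewrite /upper /= !pmulr_rgt0 // mulf_eq0 gt_eqF.
Qed.

Lemma turnZl r u v : 0 < r -> turn (scale r u) v = turn u v.
Proof.
move=> r0; rewrite /turn upperZ //; case: ifP => // _.
rewrite (_ : det2 _ v = r * det2 u v); last by rewrite /det2 /=; ring.
by rewrite sgzM gtr0_sgz ?mul1r.
Qed.

Lemma turnZr r u v : 0 < r -> turn u (scale r v) = turn u v.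
Proof. by move=> r0; rewrite turnC turnZl // turnC opprK. Qed.

Lemma upperN u : u != 0 -> upper (- u) = ~~ upper u.
Proof.
case: u => a b; rewrite /upper /= -pair_eqE /= negb_and => ab0.
by apply/idP/idP; lra.
Qed.

Lemma turnNN u v : u != 0 -> v != 0 -> turn (- u) (- v) = turn u v.
Proof.
move=> u0 v0; rewrite /turn !upperN // (inj_eq negb_inj).
by rewrite (_ : det2 (- u) (- v) = det2 u v) // /det2 /=; ring.
Qed.

(** Exactly one of [u] and [- u] is upper, so exactly one of the two turns changes half planes, and
    both carry the determinant [det2 u w]. *)
Lemma turn_opp u w : u != 0 -> turn u w + turn w (- u) = sgz (det2 u w).
Proof.
move=> u0; rewrite /turn upperN //.
rewrite (_ : det2 w (- u) = det2 u w); last by rewrite /det2 /=; ring.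
by case: (upper u); case: (upper w) => /=; rewrite ?addr0 ?add0r.
Qed.

Lemma upperD u v : upper u = upper v -> upper (u + v) = upper u.
Proof.
case: u v => [a b] [c d]; rewrite /upper /=.
by case: (boolP ((0 < b) || _)) => ub vd; apply/idP; lra.
Qed.

(** The three determinants agree; if [u] and [v] lie in different half planes, [u + v] sides with
    exactly one of them, so one turn on the left counts. *)
Lemma turnD u v : turn u (u + v) + turn (u + v) v = turn u v.
Proof.
rewrite /turn (_ : det2 u (u + v) = det2 u v); last by rewrite /det2 /=; ring.
rewrite (_ : det2 (u + v) v = det2 u v); last by rewrite /det2 /=; ring.
case: (eqVneq (upper u) (upper v)) => [uv|]; first by rewrite upperD // uv eqxx.
by case: (upper u); case: (upper v); case: (upper (u + v)) => //= _;
  rewrite ?addr0 ?add0r.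
Qed.

(** The half plane to the left of [n] contains at most one ray of the horizontal axis, and the sign
    of [n.2] tells which. So the turn is a difference of values of a potential there. *)
Lemma turn_halfplane n u v : 0 < det2 n u -> 0 < det2 n v ->
  turn u v = sgz n.2 * ((upper u)%:Z - (upper v)%:Z).
Proof.
have aux w w' : 0 < det2 n w -> 0 < det2 n w' -> upper w -> ~~ upper w' ->
    sgz (det2 w w') = sgz n.2.
  case: n w w' => [n1 n2] [a b] [c d]; rewrite /upper /det2 /= => nw nw' uw uw'.
  have b0 : 0 <= b by case/orP: uw => [/ltW //|/andP[/eqP ->]].
  have d0 : d <= 0 by move: uw'; rewrite negb_or -leNgt => /andP[].
  (* Both terms on the right are nonnegative, because [0 <= b] and [d <= 0]; one of them is
     positive, because [b] and [d] are not both 0. *)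
  have E : n2 * (a * d - b * c) = b * (n1 * d - n2 * c) - d * (n1 * b - n2 * a).
    by ring.
  have : b != 0 \/ d != 0.
    case: (eqVneq b 0) uw => [b_0|]; last by left.
    case: (eqVneq d 0) uw' => [d_0|]; last by right.
    rewrite b_0 d_0 ltxx /= -leNgt => c0 a0; exfalso.
    by move: nw nw'; rewrite b_0 d_0; nra.
  move=> bd; have {}E : 0 < n2 * (a * d - b * c).
    rewrite {}E; case: bd => [bN|dN].
    - have bp : 0 < b by rewrite lt_def bN.
      by have := mulr_gt0 bp nw'; have := mulr_ge0_le0 (ltW nw) d0; lra.
    - have dn : 0 < - d by rewrite oppr_gt0 lt_neqAle dN.
      by have := mulr_gt0 dn nw; have := mulr_ge0 b0 (ltW nw'); lra.
  case: (ltgtP n2 0) => [n0|n0|n0].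
  - by rewrite !ltr0_sgz //; rewrite nmulr_rgt0 in E.
  - by rewrite !gtr0_sgz //; rewrite pmulr_rgt0 in E.
  - by rewrite n0 mul0r ltxx in E.
move=> nu nv; rewrite /turn.
case: (boolP (upper u)) (boolP (upper v)) => [uu|uu] [uv|uv] /=;
  rewrite ?subrr ?mulr0 //.
  by rewrite (aux u v) // subr0 mulr1.
rewrite (_ : det2 u v = - det2 v u) ?sgzN ?(aux v u) //; last first.
  by rewrite /det2 /=; ring.
by rewrite sub0r mulrN1.
Qed.

(* The total turn around the quadrilateral of differences between {P, Q} and
   {x, y}: how much the turn from P to Q drops when the viewpoint moves from x
   to y, up to terms which cancel around a closed polygon. *)
Definition sweep x y P Q : int :=
  turn (P - x) (Q - x) + turn (Q - x) (Q - y)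
  + turn (Q - y) (P - y) + turn (P - y) (P - x).

(** The potential of [turn_halfplane] telescopes around the quadrilateral. *)
Lemma sweep_halfplane n x y P Q :
  0 < det2 n (P - x) -> 0 < det2 n (Q - x) ->
  0 < det2 n (P - y) -> 0 < det2 n (Q - y) -> sweep x y P Q = 0.
Proof.
move=> Px Qx Py Qy; rewrite /sweep !(turn_halfplane (n := n)) //; ring.
Qed.

(** [det2 d] is constant on the line, so the line lies to one side of [d], where [turn_halfplane]
    applies, or passes through 0, where all turns vanish. *)
Lemma turn_line u d s t : turn (u + scale s d) (u + scale t d) =
  sgz (det2 d u) * sgz d.2
    * ((upper (u + scale s d))%:Z - (upper (u + scale t d))%:Z).
Proof.
have detE r : det2 d (u + scale r d) = det2 d u by rewrite /det2 /=; ring.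
case: (ltgtP (det2 d u) 0) => [d0|d0|d0].
- rewrite (turn_halfplane (n := - d)); last 2 first.
  + by move: d0; rewrite -(detE s) /det2 /=; lra.
  + by move: d0; rewrite -(detE t) /det2 /=; lra.
  by rewrite (ltr0_sgz d0) sgzN mulN1r.
- by rewrite (turn_halfplane (n := d)) ?detE // (gtr0_sgz d0) mul1r.
- rewrite turn_det0 ?d0 ?sgz0 ?mul0r //.
  have -> : det2 (u + scale s d) (u + scale t d) = (s - t) * det2 d u.
    by rewrite /det2 /=; ring.
  by rewrite d0 mulr0.
Qed.

(* Each turn is a difference of values of one function along a line, so the
   sweep is additive along the line. *)
Lemma sweep_line_cat x D P Q r s t :
  sweep (x + scale r D) (x + scale s D) P Q
  + sweep (x + scale s D) (x + scale t D) P Q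
  = sweep (x + scale r D) (x + scale t D) P Q.
Proof.
have lineE W s' t' : turn (W - (x + scale s' D)) (W - (x + scale t' D)) =
    turn (W - x + scale s' (- D)) (W - x + scale t' (- D)).
  by congr turn; rewrite opprD addrA; congr (_ + _); congr (_, _);
    rewrite /= mulrN.
rewrite /sweep !lineE !turn_line.
rewrite (turnC (Q - _) (P - (x + scale s D))).
ring.
Qed.

Lemma sweepC x y P Q : sweep y x P Q = - sweep x y P Q.
Proof.
rewrite /sweep (turnC (Q - x) (P - x)) (turnC (Q - x) (Q - y)).
rewrite (turnC (P - y) (Q - y)) (turnC (P - y) (P - x)); ring.
Qed.

(** Each vertex is the end of one edge and the start of another, and the turns between its two
    differences cancel. *)
Lemma sweep_sum (I : finType) (f : I -> I) (V : I -> R * R) x y :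
  bijective f ->
  \sum_i sweep x y (V i) (V (f i)) =
  \sum_i turn (V i - x) (V (f i) - x) - \sum_i turn (V i - y) (V (f i) - y).
Proof.
move=> fb; rewrite /sweep !big_split /=.
have -> : \sum_i turn (V (f i) - x) (V (f i) - y) =
    \sum_i turn (V i - x) (V i - y).
  by rewrite [RHS](reindex f) //; exact: onW_bij.
have -> : \sum_i turn (V (f i) - y) (V i - y) =
    - \sum_i turn (V i - y) (V (f i) - y).
  by rewrite -sumrN; apply: eq_bigr => i _; rewrite turnC.
have -> : \sum_i turn (V i - y) (V i - x) = - \sum_i turn (V i - x) (V i - y).
  by rewrite -sumrN; apply: eq_bigr => i _; rewrite turnC.
ring.
Qed.

(* The point x lies at time l / (l + m) on the edge from P to Q. *)
Lemma sweep_from_crossing x D B r l m : 0 < l -> 0 < m -> B != 0 ->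
  sweep x (x + scale r D) (x - scale l B) (x + scale m B) =
  sgz r * sgz (det2 D B).
Proof.
move=> l0 m0 B0; rewrite /sweep.
set w1 := x + scale m B - (x + scale r D).
set w2 := x - scale l B - (x + scale r D).
have -> : x - scale l B - x = scale l (- B).
  by rewrite addrC addKr; congr (_, _); rewrite /= mulrN.
have -> : x + scale m B - x = scale m B by rewrite addrC addKr.
rewrite [turn (scale l _) _]turn_det0 ?add0r; last by rewrite /det2 /=; ring.
rewrite turnZl // turnZr //.
(* Since [w2] is [w1] plus a positive multiple of [- B], the turns from [w1] to [w2] to [- B] merge
   into one, which completes the half turn begun at [B]. *)
have {1}-> : w2 = w1 + scale (l + m) (- B).
  rewrite /w1 /w2; case: (x) (B) (D) => [x1 x2] [b1 b2] [d1 d2].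
  by congr (_, _); rewrite /=; ring.
have -> : turn w2 (- B) = turn (w1 + scale (l + m) (- B)) (scale (l + m) (- B)).
  rewrite turnZr ?addr_gt0 //; congr turn.
  rewrite /w1 /w2; case: (x) (B) (D) => [x1 x2] [b1 b2] [d1 d2].
  by congr (_, _); rewrite /=; ring.
rewrite -addrA turnD turnZr ?addr_gt0 // turn_opp //.
rewrite -sgzM; congr sgz; rewrite /w1.
by case: (x) (B) (D) => [x1 x2] [b1 b2] [d1 d2]; rewrite /det2 /=; ring.
Qed.
Lemma sweep_collinear x y P Q : det2 (P - x) (Q - P) = 0 ->
  det2 (P - x) (y - x) = 0 -> det2 (Q - P) (y - x) = 0 -> sweep x y P Q = 0.
Proof.
case: x y P Q => [x1 x2] [y1 y2] [p1 p2] [q1 q2].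
by rewrite /sweep /det2 /= => e1 e2 e3;
  rewrite !turn_det0 ?addr0 //; rewrite /det2 /=; lra.
Qed.

Lemma sweep_refl x P Q : sweep x x P Q = 0.
Proof. by have := sweepC x x P Q; lia. Qed.

(** If the two lines meet, one of them has its meeting time outside [0, 1], so the segment on it
    lies strictly to one side of the other line. This, or strict parallelism, puts all four
    differences in one half plane; on a common line all turns vanish. *)
Lemma sweep_disjoint x y P Q :
  (forall r t, 0 <= r <= 1 -> 0 <= t <= 1 ->
     x + scale r (y - x) <> P + scale t (Q - P)) ->
  sweep x y P Q = 0.
Proof.
move=> dis; case: (eqVneq (y - x) 0) => [/eqP|D0].
  by rewrite subr_eq0 => /eqP ->; exact: sweep_refl.
have [d0|dN] := eqVneq (det2 (y - x) (Q - P)) 0.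
  have [e0|eN] := eqVneq (det2 (y - x) (P - x)) 0.
    case: x y P Q D0 d0 e0 {dis} => [x1 x2] [y1 y2] [p1 p2] [q1 q2].
    rewrite /det2 /= -pair_eqE /= => D0 d0 e0; apply: sweep_collinear.
    (* [P - x] and [Q - P] are both parallel to the nonzero [y - x], hence to each other. *)
    - rewrite /det2 /=; move: D0; rewrite negb_and.
      case/orP => D0; apply: (mulfI D0).
      + have := congr1 ( *%R (p1 - x1)) d0; have := congr1 ( *%R (q1 - p1)) e0.
        by rewrite /=; lra.
      + have := congr1 ( *%R (p2 - x2)) d0; have := congr1 ( *%R (q2 - p2)) e0.
        by rewrite /=; lra.
    - by rewrite /det2 /=; lra.
    - by rewrite /det2 /=; lra.
  apply: (sweep_halfplane (n := scale (det2 (y - x) (P - x)) (y - x)));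
    (have eP : 0 < det2 (y - x) (P - x) ^+ 2
      by rewrite lt_def sqrf_eq0 eN sqr_ge0);
    (have dE := congr1 ( *%R (det2 (y - x) (P - x))) d0); move: eP dE;
    rewrite /det2 /=; lra.
pose r := det2 (P - x) (Q - P) / det2 (y - x) (Q - P).
pose t := det2 (P - x) (y - x) / det2 (y - x) (Q - P).
have rE : det2 (P - x) (Q - P) = r * det2 (y - x) (Q - P) by rewrite /r divfK.
have tE : det2 (P - x) (y - x) = t * det2 (y - x) (Q - P) by rewrite /t divfK.
have rt : x + scale r (y - x) = P + scale t (Q - P).
  move: dN rE tE; move: (r) (t) => r' t'.
  case: x y P Q {dis D0 r t} => [x1 x2] [y1 y2] [p1 p2] [q1 q2].
  rewrite /det2 /= => dN rE tE; congr (_, _) => /=.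
  - apply: (mulfI dN); have := congr1 ( *%R (y1 - x1)) rE.
    by have := congr1 ( *%R (q1 - p1)) tE; rewrite /=; lra.
  - apply: (mulfI dN); have := congr1 ( *%R (y2 - x2)) rE.
    by have := congr1 ( *%R (q2 - p2)) tE; rewrite /=; lra.
have {dis} : ~~ ((0 <= r <= 1) && (0 <= t <= 1)).
  by apply/negP => /andP[r01 t01]; exact: (dis r t).
have dd : 0 < det2 (y - x) (Q - P) ^+ 2 by rewrite lt_def sqrf_eq0 dN sqr_ge0.
have scE c u v : det2 (scale c u) v = c * det2 u v by rewrite /det2 /=; ring.
have BPx : det2 (Q - P) (P - x) = - r * det2 (y - x) (Q - P).
  by move: rE; rewrite /det2 /=; lra.
have BQx : det2 (Q - P) (Q - x) = - r * det2 (y - x) (Q - P).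
  by move: rE; rewrite /det2 /=; lra.
have BPy : det2 (Q - P) (P - y) = (1 - r) * det2 (y - x) (Q - P).
  by move: rE; rewrite /det2 /=; lra.
have BQy : det2 (Q - P) (Q - y) = (1 - r) * det2 (y - x) (Q - P).
  by move: rE; rewrite /det2 /=; lra.
have DPx : det2 (y - x) (P - x) = - t * det2 (y - x) (Q - P).
  by move: tE; rewrite /det2 /=; lra.
have DPy : det2 (y - x) (P - y) = - t * det2 (y - x) (Q - P).
  by move: tE; rewrite /det2 /=; lra.
have DQx : det2 (y - x) (Q - x) = (1 - t) * det2 (y - x) (Q - P).
  by move: tE; rewrite /det2 /=; lra.
have DQy : det2 (y - x) (Q - y) = (1 - t) * det2 (y - x) (Q - P).
  by move: tE; rewrite /det2 /=; lra.
rewrite !negb_and -!ltNge -orbA; case/or4P => [r0|r1|t0|t1].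
(* The factor in [n] makes each of the four determinants a positive multiple of a square. *)
- apply: (sweep_halfplane (n := scale (det2 (y - x) (Q - P)) (Q - P)));
    by rewrite scE ?(BPx, BQx, BPy, BQy); nra.
- apply: (sweep_halfplane (n := scale (- det2 (y - x) (Q - P)) (Q - P)));
    by rewrite scE ?(BPx, BQx, BPy, BQy); nra.
- apply: (sweep_halfplane (n := scale (det2 (y - x) (Q - P)) (y - x)));
    by rewrite scE ?(DPx, DQx, DPy, DQy); nra.
- apply: (sweep_halfplane (n := scale (- det2 (y - x) (Q - P)) (y - x)));
    by rewrite scE ?(DPx, DQx, DPy, DQy); nra.
Qed.

(** The motion is split at the crossing point, and each half is given by [sweep_from_crossing].
    Passing right through counts twice, once on arrival and once on departure. *)
Lemma sweep_crossing x D P Q r r' s t : 0 < r' < 1 -> det2 D (Q - P) != 0 ->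
  x + scale r D = P + scale r' (Q - P) ->
  sweep (x + scale s D) (x + scale t D) P Q =
  (sgz (t - r) - sgz (s - r)) * sgz (det2 D (Q - P)).
Proof.
case/andP=> r0 r1 dN xP.
have B0 : Q - P != 0.
  by apply: contraNneq dN => ->; rewrite /det2 /= !mulr0 subrr.
have from z : sweep (x + scale r D) (x + scale z D) P Q =
    sgz (z - r) * sgz (det2 D (Q - P)).
  have := sweep_from_crossing (x + scale r D) D (z - r) r0 _ B0.
  move=> /(_ (1 - r')); rewrite subr_gt0 => /(_ r1) <-.
  congr sweep.
  - by case: (x) (D) => [x1 x2] [d1 d2]; congr (_, _); rewrite /=; ring.
  - by rewrite xP addrK.
  - by rewrite xP; case: (P) (Q) => [p1 p2] [q1 q2]; congr (_, _);
      rewrite /=; ring.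
by rewrite -(sweep_line_cat _ _ _ _ s r) sweepC !from; ring.
Qed.

(** The viewpoint ends at the start of an edge with direction [B]: one corner of the quadrilateral
    is 0, and the two remaining turns compose. *)
Lemma sweep_to_source x D r B : 0 < r ->
  sweep x (x + scale r D) (x + scale r D) (x + scale r D + B) = turn D B.
Proof.
move=> r0; rewrite /sweep subrr.
have -> : x + scale r D - x = scale r D by rewrite addrC addKr.
have -> : x + scale r D + B - x = scale r D + B.
  by rewrite addrC !addrA addNr add0r.
have -> : x + scale r D + B - (x + scale r D) = B by rewrite addrC addKr.
rewrite [turn B 0]turn_det0 1?[turn 0 _]turn_det0 ?addr0 //.
- by rewrite turnD turnZl.
- by rewrite /det2 /=; ring.
- by rewrite /det2 /=; ring.
Qed.

Lemma sweep_to_target x D r B : r < 0 -> D != 0 -> B != 0 ->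
  sweep x (x + scale r D) (x + scale r D - B) (x + scale r D) = turn B D.
Proof.
move=> r0 D0 B0; rewrite /sweep subrr.
have -> : x + scale r D - x = - scale (- r) D.
  by rewrite addrC addKr; congr (_, _); rewrite /= ?mulNr opprK.
have -> : x + scale r D - B - x = - B - scale (- r) D.
  rewrite addrC !addrA addNr add0r addrC; congr (- B + _).
  by congr (_, _); rewrite /= ?mulNr opprK.
have -> : x + scale r D - B - (x + scale r D) = - B by rewrite addrC addKr.
rewrite ![turn _ 0]turn_det0 1?[turn 0 _]turn_det0 ?addr0.
- rewrite addrC turnD turnNN ?turnZr ?oppr_gt0 //.
  apply: contraNneq D0 => /eqP; rewrite -!pair_eqE /= !mulf_eq0 oppr_eq0.
  by rewrite (lt_eqF r0).
- by rewrite /det2 /=; ring.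
- by rewrite /det2 /=; ring.
Qed.
End Turn.

(** * Winding numbers of a pair of closed polygons *)

Section PolygonWinding.
Variables (R : realType) (nv : bool -> nat) (v : forall i, 'I_(nv i) -> R * R).
Hypothesis v_generic : generic v.
Implicit Types (a b : edge_of nv) (s t r : R).

Definition next_edge a : edge_of nv :=
  Tagged (fun i => 'I_(nv i)) (ordS (tagged a)).

Lemma next_edge_bij : bijective next_edge.
Proof.
exists (fun a => Tagged (fun i => 'I_(nv i)) (ord_pred (tagged a))) => [] [i k].
- by rewrite /next_edge /= ordSK.
- by rewrite /next_edge /= ord_predK.
Qed.

Lemma direction_target a : direction v a = source v (next_edge a) - source v a.
Proof. by []. Qed.

Lemma point_atE a s : point_at v a s = source v a + scale s (direction v a).
Proof. by []. Qed.

Lemma point_at0 a : point_at v a 0 = source v a.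
Proof.
by rewrite /point_at !mul0r !addr0; case: (source v a).
Qed.

Lemma point_at1 a : point_at v a 1 = source v (next_edge a).
Proof.
rewrite /point_at !mul1r direction_target /= !subrKC.
by case: (source v _).
Qed.

(** Otherwise the times 0 and 1/2 would give one point, while genericity allows no double point at
    time 0. *)
Lemma direction_neq0 a : direction v a != 0.
Proof.
apply/eqP => a0; have [] := v_generic.1 a a 0 2^-1.
- by rewrite lexx ltr01.
- by apply/andP; split; lra.
- by case=> /eqP; rewrite eq_sym invr_eq0 pnatr_eq0.
- by rewrite /point_at a0 /= !mulr0.
- by rewrite ltxx.
Qed.

Lemma crosses_det_neq0 a b : crosses v a b ->
  det2 (direction v a) (direction v b) != 0.
Proof. by case/and3P. Qed.

Lemma crossing_point a b : crosses v a b ->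
  point_at v a (crossing_time v a b) = point_at v b (crossing_time v b a).
Proof.
case/and3P=> d0 _ _; move: d0; rewrite /point_at /crossing_time.
case: (direction v a) (direction v b) => [x1 y1] [x2 y2].
case: (source v a) (source v b) => [x3 y3] [x4 y4]; rewrite /det2 /= => d0.
have d1 : x2 * y1 - y2 * x1 != 0.
  by rewrite (_ : _ - _ = - (x1 * y2 - y1 * x2)) ?oppr_eq0 //; ring.
by congr (_, _); field; rewrite d0 d1.
Qed.

Lemma crossesC a b : crosses v a b = crosses v b a.
Proof.
have detC : det2 (direction v a) (direction v b) =
    - det2 (direction v b) (direction v a) by rewrite /det2; ring.
rewrite /crosses andbCA [in RHS]andbCA detC oppr_eq0.
by rewrite andbC -andbA andbCA.
Qed.

Lemma crosses_time a b : crosses v a b -> 0 < crossing_time v a b < 1.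
Proof. by case/and3P. Qed.

Lemma meet_cases a b s t : 0 <= s <= 1 -> 0 <= t <= 1 ->
  point_at v a s = point_at v b t ->
  [\/ crosses v a b, a = b, s = 1 /\ b = next_edge a
    | s = 0 /\ next_edge b = a].
Proof.
(* Genericity speaks of half-open edges, so time 1 on an edge is replaced by time 0 on the next
   one. *)
have shift c r : 0 <= r <= 1 -> exists c' r',
    [/\ 0 <= r' < 1, point_at v c r = point_at v c' r' &
        (c', r') = (c, r) \/ [/\ r = 1, c' = next_edge c & r' = 0]].
  move=> /andP[r0 r1]; case: (eqVneq r 1) => [->|rN].
    exists (next_edge c), 0; rewrite lexx ltr01 point_at1 point_at0.
    by split=> //; right.
  by exists c, r; rewrite r0 lt_neqAle rN r1; split=> //; left.
move=> s01 t01; have [a' [s' [s'01 -> sE]]] := shift a s s01.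
have [b' [t' [t'01 -> tE]]] := shift b t t01 => e.
have [[ab st]|ne] := eqVneq (a', s') (b', t').
  subst a' s'; case: sE tE => [[? ?]|[s1 ? ?]] [[? ?]|[t1 ? ?]]; subst.
  - by constructor 2.
  - by constructor 4.
  - by constructor 3.
  - by constructor 2; apply: (bij_inj next_edge_bij).
have [s0 t0 d0] := v_generic.1 a' b' s' t' s'01 t'01 (elimN eqP ne) e.
case: sE s0 s'01 => [[? ?]|[_ _ ->]]; last by rewrite ltxx.
case: tE t0 t'01 => [[? ?]|[_ _ ->]]; last by rewrite ltxx.
subst => t0 /andP[_ t1] s0 /andP[_ s1]; constructor 1.
by apply/crossesP => //; exists s, t; rewrite s0 s1 t0 t1.
Qed.

(** Only edges met by the path from the midpoint of [a] contribute: those crossing [a], and a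
    neighbour of [a] when the path ends at their common vertex. *)
Lemma sweep_edge a b s : 0 <= s <= 1 ->
  sweep (point_at v a 2^-1) (point_at v a s)
    (source v b) (source v (next_edge b)) =
  if crosses v a b then
    (sgz (s - crossing_time v a b) - sgz (2^-1 - crossing_time v a b))
    * sgz (det2 (direction v a) (direction v b))
  else if (s == 1) && (b == next_edge a) then
    turn (direction v a) (direction v b)
  else if (s == 0) && (next_edge b == a) then
    turn (direction v b) (direction v a)
  else 0.
Proof.
move=> s01; have h0 : (0 : R) < 2^-1 by rewrite invr_gt0 ltr0n.
have h1 : (2^-1 : R) < 1 by rewrite invf_lt1 ?ltr0n // ltr1n.
have move_to t : point_at v a t =
    point_at v a 2^-1 + scale (t - 2^-1) (direction v a).
  rewrite /point_at; case: (direction v a) => [d1 d2].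
  by congr (_, _); rewrite /=; ring.
case: ifP => [ab|abN].
  rewrite !point_atE; apply: sweep_crossing.
  - exact: (crosses_time (etrans (crossesC b a) ab)).
  - exact: crosses_det_neq0 ab.
  - by rewrite -!point_atE crossing_point.
case: ifP => [/andP[/eqP -> /eqP ->]|sbN].
  have -> : source v (next_edge (next_edge a)) = point_at v a 2^-1 +
      scale (1 - 2^-1) (direction v a) + direction v (next_edge a).
    by rewrite -move_to point_at1 direction_target subrKC.
  by rewrite -point_at1 (move_to 1) sweep_to_source // subr_gt0.
case: ifP => [/andP[/eqP -> /eqP ba]|tbN].
  have -> : source v b = point_at v a 2^-1 +
      scale (0 - 2^-1) (direction v a) - direction v b.
    by rewrite -move_to point_at0 direction_target ba subKr.
  rewrite ba -(point_at0 a) (move_to 0) sweep_to_target ?direction_neq0 //.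
  by rewrite sub0r oppr_lt0.
have [->|ab] := eqVneq a b.
  apply: sweep_collinear; rewrite -?direction_target /point_at /det2 /=; ring.
apply: sweep_disjoint => r t /andP[r0 r1] t01 e.
(* [z] is the time on [a] of the point at fraction [r] of the path; it can be 0 or 1 only if [s]
   is. *)
pose z := 2^-1 + r * (s - 2^-1).
case/andP: s01 => s0 s1.
have z01 : 0 <= z <= 1 by rewrite /z; apply/andP; split; nra.
have : point_at v a z = point_at v b t.
  rewrite point_atE -direction_target in e; rewrite [RHS]point_atE -e /point_at.
  by congr (_, _); rewrite /z /=; ring.
case/(meet_cases z01 t01) => [ab'|ab'|[z1 ab']|[z0 ab']].
- by rewrite ab' in abN.
- by rewrite ab' eqxx in ab.
- move: sbN; rewrite ab' eqxx andbT => /eqP; apply.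
  by move: z1; rewrite /z; nra.
- move: tbN; rewrite ab' eqxx andbT => /eqP; apply.
  by move: z0; rewrite /z; nra.
Qed.

(** Cramer's rule puts the meeting point at time 1, outside the open interval. *)
Lemma crosses_nextF a : crosses v a (next_edge a) = false.
Proof.
apply/negP => an; have := crosses_time an; rewrite /crossing_time.
by rewrite -direction_target divff ?crosses_det_neq0 // ltxx andbF.
Qed.

(** Twice the winding number about [q], summed over both polygons. *)
Definition winding (q : R * R) : int :=
  \sum_b turn (source v b - q) (source v (next_edge b) - q).

(* Along the edge a, [winding] drops by the sign of each crossing both on
   arrival at and on departure from it; [crossing_sum a] compensates for this. *)
Definition crossing_sum a s : int :=
  \sum_(b | crosses v a b)
     sgz (det2 (direction v a) (direction v b)) * sgz (s - crossing_time v a b).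

Definition crossing_total a : int :=
  \sum_(b | crosses v a b) sgz (det2 (direction v a) (direction v b)).

(** The constant value of [winding] plus [crossing_sum] inside [a]. The midpoint may itself be a
    double point, since both terms take mean values there. *)
Definition mid_edge a : int :=
  winding (point_at v a 2^-1) + crossing_sum a 2^-1.

Lemma sweep_winding x y :
  \sum_b sweep x y (source v b) (source v (next_edge b)) =
  winding x - winding y.
Proof. by apply: sweep_sum; exact: next_edge_bij. Qed.

Lemma crossing_sumB a s t : crossing_sum a s - crossing_sum a t =
  \sum_b if crosses v a b then
    (sgz (s - crossing_time v a b) - sgz (t - crossing_time v a b))
    * sgz (det2 (direction v a) (direction v b)) else 0.
Proof.
rewrite -big_mkcond -sumrB; apply: eq_bigr => b _.
by rewrite mulrBl ![_ * sgz (det2 _ _)]mulrC.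
Qed.

Lemma crossing_sum1 a : crossing_sum a 1 = crossing_total a.
Proof.
apply: eq_bigr => b ab; have /andP[_ lt1] := crosses_time ab.
by rewrite [sgz (1 - _)]gtr0_sgz ?subr_gt0 // mulr1.
Qed.

Lemma crossing_sum0 a : crossing_sum a 0 = - crossing_total a.
Proof.
rewrite -sumrN; apply: eq_bigr => b ab; have /andP[gt0 _] := crosses_time ab.
by rewrite [sgz (0 - _)]ltr0_sgz ?sub0r ?oppr_lt0 // mulrN1.
Qed.

Lemma winding_inner a s : 0 < s < 1 ->
  winding (point_at v a s) + crossing_sum a s = mid_edge a.
Proof.
case/andP=> s0 s1.
have := sweep_winding (point_at v a 2^-1) (point_at v a s).
rewrite (eq_bigr _ (fun b _ => sweep_edge a b _)) ?ltW //.
rewrite (lt_eqF s1) (gt_eqF s0) /= -crossing_sumB /mid_edge; lia.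
Qed.

(* The two edges at a vertex contribute 0 to [winding] there; the turn between
   them makes up for it. *)
Lemma winding_target a :
  winding (source v (next_edge a))
  + turn (direction v a) (direction v (next_edge a)) + crossing_total a =
  mid_edge a.
Proof.
have := sweep_winding (point_at v a 2^-1) (point_at v a 1).
rewrite (eq_bigr _ (fun b _ => sweep_edge a b _)) ?ler01 ?lexx //.
rewrite oner_eq0 /= (bigD1 (next_edge a)) //= crosses_nextF !eqxx /= => E.
have := crossing_sumB a 1 2^-1; rewrite (bigD1 (next_edge a)) //= crosses_nextF.
rewrite add0r => E1; rewrite (eq_bigr (fun b => if crosses v a b then
    (sgz (1 - crossing_time v a b) - sgz (2^-1 - crossing_time v a b))
    * sgz (det2 (direction v a) (direction v b)) else 0)) in E; last first.
  by move=> b /negbTE ->.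
move: E; rewrite -E1 point_at1 crossing_sum1 /mid_edge; lia.
Qed.

(** The same vertex as in [winding_target], now reached backwards along the next edge; the
    correction by the turn is the same. *)
Lemma winding_source a :
  winding (source v (next_edge a))
  + turn (direction v a) (direction v (next_edge a))
  - crossing_total (next_edge a)
  = mid_edge (next_edge a).
Proof.
set a' := next_edge a.
have := sweep_winding (point_at v a' 2^-1) (point_at v a' 0).
rewrite (eq_bigr _ (fun b _ => sweep_edge a' b _)) ?ler01 ?lexx //.
rewrite (bigD1 a) //= crossesC crosses_nextF !eqxx.
rewrite [0 == 1]eq_sym oner_eq0 /= => E.
have := crossing_sumB a' 0 2^-1; rewrite (bigD1 a) //= crossesC crosses_nextF.
rewrite add0r => E1; rewrite (eq_bigr (fun b => if crosses v a' b then
    (sgz (0 - crossing_time v a' b) - sgz (2^-1 - crossing_time v a' b))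
    * sgz (det2 (direction v a') (direction v b)) else 0)) in E; last first.
  by move=> b /negbTE ba; rewrite (inj_eq (bij_inj next_edge_bij)) ba.
move: E; rewrite -E1 point_at0 crossing_sum0 /mid_edge; lia.
Qed.

(** The two sides are the values of [winding] just after and just before the common vertex. *)
Lemma mid_edge_next a :
  mid_edge (next_edge a) + crossing_total (next_edge a) =
  mid_edge a - crossing_total a.
Proof. by rewrite -winding_source -winding_target; lia. Qed.

(** Along each edge [winding] drops by twice its [crossing_total]. [K] is the value just after the
    first vertex; returning to it around the closed polygon makes the totals add up to 0. *)
Lemma mid_edge_along i : exists2 K : int,
    forall k : 'I_(nv i),
      mid_edge (Tagged _ k) + crossing_total (Tagged _ k) =
      K - 2 * \sum_(m < nv i | (m < k)%N) crossing_total (Tagged _ m)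
  & \sum_(m < nv i) crossing_total (Tagged (fun i => 'I_(nv i)) m) = 0.
Proof.
pose T (m : 'I_(nv i)) := crossing_total (Tagged (fun i => 'I_(nv i)) m).
have [n0|n_gt0] := posnP (nv i).
  have no (m : 'I_(nv i)) : False by case: m => m; rewrite n0.
  by exists 0 => [k|]; [case: (no k) | rewrite big1 // => m; case: (no m)].
pose A k (kn : (k < nv i)%N) : edge_of nv :=
  Tagged (fun i => 'I_(nv i)) (Ordinal kn).
pose K : int := mid_edge (A 0 n_gt0) + crossing_total (A 0 n_gt0).
have along k (kn : (k < nv i)%N) :
    mid_edge (A k kn) + crossing_total (A k kn) =
    K - 2 * \sum_(m < nv i | (m < k)%N) T m.
  elim: k kn => [|k IHk] kn.
    by rewrite big_pred0 // mulr0 subr0 /K (bool_irrelevance kn n_gt0).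
  have kn' := ltnW kn.
  have -> : A k.+1 kn = next_edge (A k kn').
    by congr Tagged; apply: val_inj; rewrite /= modn_small.
  rewrite mid_edge_next // (bigD1 (Ordinal kn')) //=.
  rewrite (eq_bigl (fun m : 'I_(nv i) => (m < k)%N)); last first.
    by move=> m; rewrite -val_eqE /= ltnS [in RHS]ltn_neqAle andbC.
  have := IHk kn'; rewrite -[crossing_total (A k kn')]/(T (Ordinal kn')).
  by move: (mid_edge _) (T _) (\sum_(m | _) _) => x y z; lia.
exists K => [[k kn]|]; first exact: along.
have ln : ((nv i).-1 < nv i)%N by rewrite ltn_predL.
have := mid_edge_next (A _ ln).
have -> : next_edge (A (nv i).-1 ln) = A 0 n_gt0.
  by congr Tagged; apply: val_inj; rewrite /= prednK // modnn.
have := along _ ln; rewrite -/K.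
rewrite [X in _ -> _ -> X = 0](bigD1 (Ordinal ln)) //=.
rewrite [in X in _ -> _ -> _ + X = _](eq_bigl
  (fun m : 'I_(nv i) => (m < (nv i).-1)%N)).
  rewrite -[crossing_total (A _ ln)]/(T (Ordinal ln)) -/K.
  by move: (mid_edge _) (T _) (\sum_(m | _) _) => x y z; lia.
case=> m mn; rewrite -val_eqE /=; move: mn (n_gt0); case: (nv i) => // n.
by move=> mn _ /=; rewrite [RHS]ltn_neqAle -ltnS mn andbT.
Qed.
End PolygonWinding.

(** * Winding numbers at the double points of a diagram *)

Section DiagramWinding.
Variables (R : realType) (D : virtual_diagram R).
Hypothesis D_classical : classical D.
Implicit Types (a b : edge D) (e f : classical_crossing D * bool).
Notation v := (@vertex R D).

Lemma strand_crosses e : crosses v (strand e) (other_strand e).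
Proof.
case: e => [[[a b] ab] []]; rewrite /strand /other_strand /=.
  exact: over_crosses ab.
by rewrite crossesC; exact: over_crosses ab.
Qed.

(** In a classical diagram each crossing of [a] with [b] is recorded exactly once in [over], as (a,
    b) or as (b, a), so it gives exactly one arrow endpoint on [a]. *)
Lemma sum_strand (F : edge D -> int) a :
  \sum_(e | strand e == a) F (other_strand e) = \sum_(b | crosses v a b) F b.
Proof.
pose G (x : edge D * edge D) s :=
  if (if s then x.1 else x.2) == a then F (if s then x.2 else x.1) else 0.
transitivity (\sum_(c : classical_crossing D) \sum_s G (val c) s).
  rewrite big_mkcond /= pair_bigA /=; apply: eq_bigr => -[c s] _.
  by rewrite /strand /other_strand /G /=; case: s.
rewrite -(big_sub (Defs.over D) (fun x => \sum_s G x s)).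
rewrite [RHS]big_mkcond [LHS]big_mkcond /=.
under eq_bigr do rewrite big_bool /=.
rewrite (eq_bigr (fun x : edge D * edge D =>
   (if x.1 == a then if (x.1, x.2) \in Defs.over D then F x.2 else 0 else 0)
   + (if x.2 == a then if (x.1, x.2) \in Defs.over D then F x.1 else 0
      else 0))).
  2:{ by case=> x y _ /=; rewrite /G /=; case: (_ \in _);
      rewrite ?if_same ?addr0. }
rewrite big_split /=.
rewrite -(pair_bigA _ (fun x y =>
  if x == a then if (x, y) \in Defs.over D then F y else 0 else 0)).
rewrite -(pair_bigA _ (fun x y =>
  if y == a then if (x, y) \in Defs.over D then F x else 0 else 0)) /=.
rewrite [X in _ + X]exchange_big /= -big_split /= (bigD1 a) //= eqxx.
rewrite [X in _ + X]big1.
  2:{ by move=> b /negbTE ->; rewrite !big1_eq addr0. }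
rewrite addr0 -big_split /=; apply: eq_bigr => b _.
have [abo|abo] := boolP ((a, b) \in Defs.over D).
  by rewrite (over_crosses abo) (negbTE (over_asym abo)) addr0.
have [bao|bao] := boolP ((b, a) \in Defs.over D).
  by rewrite crossesC (over_crosses bao) add0r.
rewrite addr0; case: ifP => // /D_classical.
by rewrite (negbTE abo) (negbTE bao) => -[].
Qed.

Definition crossing_at e : R := crossing_time v (strand e) (other_strand e).

Definition crossing_sign_at e : int :=
  sgz (det2 (direction v (strand e)) (direction v (other_strand e))).

Definition double_point e : R * R := point_at v (strand e) (crossing_at e).

Lemma double_point_tail_head (c : classical_crossing D) :
  double_point (c, true) = double_point (c, false).
Proof. exact: crossing_point (strand_crosses (c, true)). Qed.

Lemma crossing_at01 e : 0 < crossing_at e < 1.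
Proof. exact: crosses_time (strand_crosses e). Qed.

(** At a head the strands are exchanged, which reverses the determinant just as the label rule
    reverses the sign. *)
Lemma jumpE e : jump (e : arrow (gauss_of D) * bool) = crossing_sign_at e.
Proof.
case: e => c s; rewrite /jump /sign /crossing_sign_at /strand /other_strand /=.
have := crosses_det_neq0 (strand_crosses (c, true)).
rewrite /strand /other_strand /=.
rewrite /crossing_positive => d0; case: s => /=.
  by move: d0; case: sgzP => //; rewrite ?ltxx.
rewrite [in RHS](_ : det2 _ _ =
  - det2 (direction v (val c).1) (direction v (val c).2)).
  by rewrite sgzN; move: d0; case: sgzP => //; rewrite ?ltxx.
by rewrite /det2; ring.
Qed.

Lemma position_lt e f :
  (tagged (strand e) < tagged (strand f))%N -> position e < position f.
Proof.
rewrite -(ler_nat R) /position -/(crossing_at e) -/(crossing_at f).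
have /andP[_ e1] := crossing_at01 e; have /andP[f0 _] := crossing_at01 f.
by rewrite -natr1; lra.
Qed.

(** The integer part of the position gives the edge and the fractional part the time. The absence of
    triple points then fixes the other strand, and asymmetry of [over] tells tail from head. *)
Lemma position_inj e f : tag (strand e) = tag (strand f) ->
  position e = position f -> e = f.
Proof.
move=> tef pef.
have sef : strand e = strand f.
  case: (ltngtP (tagged (strand e)) (tagged (strand f))) => [lt|lt|].
  - by have := position_lt lt; rewrite pef ltxx.
  - by have := position_lt lt; rewrite pef ltxx.
  move: tef; case: (strand e) (strand f) => [i k] [j m] /= ij; subst j.
  by move/val_inj => ->.
have tE : crossing_at e = crossing_at f.
  by move: pef; rewrite /position sef => /addrI; rewrite -/(crossing_at f) -sef.
have oef : other_strand e = other_strand f.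
  apply/eqP; apply: contraT => oN.
  have ne (g : classical_crossing D * bool) : strand g <> other_strand g.
    move=> E; have := crosses_det_neq0 (strand_crosses g).
    by rewrite E /det2 mulrC subrr eqxx.
  pose tr (g : classical_crossing D * bool) :=
      crossing_time v (other_strand g) (strand g).
  have tr01 g : 0 <= tr g < 1.
    have := strand_crosses g; rewrite crossesC => /crosses_time /andP[t0 t1].
    by rewrite ltW.
  have ca01 g : 0 <= crossing_at g < 1.
    by have /andP[t0 t1] := crossing_at01 g; rewrite ltW.
  have [_ triple] := vertex_generic D.
  case: (triple (strand e) (other_strand e) (other_strand f) (crossing_at e)
    (tr e) (tr f) (ca01 e) (tr01 e) (tr01 f)).
  - by case => /ne.
  - by rewrite sef => -[/ne].
  - by case => E; rewrite E eqxx in oN.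
  - exact: crossing_point (strand_crosses e).
  - by rewrite tE sef; exact: crossing_point (strand_crosses f).
case: e f sef oef {tef pef tE} => [[[a b] ab] s] [[[a' b'] ab'] s'].
rewrite /strand /other_strand /=; case: s s' => [] [] /= ? ?; subst.
- by rewrite (bool_irrelevance ab ab').
- by case/negP: (over_asym ab).
- by case/negP: (over_asym ab).
- by rewrite (bool_irrelevance ab ab').
Qed.

Lemma sum_component i (F : edge D -> int) :
  \sum_(a | tag a == i) F a =
  \sum_(m < nv D i) F (Tagged (fun i => 'I_(nv D i)) m).
Proof.
transitivity (\sum_(j | j == i)
    \sum_(m < nv D j) F (Tagged (fun i => 'I_(nv D i)) m)); last first.
  by rewrite big_pred1_eq.
rewrite sig_big_dep; apply: eq_big => [[j m]|[j m] _] //=.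
by rewrite andbT.
Qed.

(** The weight is 2 for endpoints already passed, 1 for [e] itself, where only the arrival counts,
    and 0 for those ahead. *)
Lemma winding_double_point i : exists2 K : int,
    forall e, tag (strand e) = i -> winding v (double_point e) =
      K - \sum_(f | tag (strand f) == i)
            crossing_sign_at f * (1 + sgz (position e - position f))
  & \sum_(f | tag (strand f) == i) crossing_sign_at f = 0.
Proof.
have sumE (F : edge D -> edge D -> int) :
    \sum_(f | tag (strand f) == i) F (strand f) (other_strand f) =
    \sum_(m < nv D i) \sum_(b | crosses v (Tagged _ m) b) F (Tagged _ m) b.
  rewrite (partition_big (@strand R D) (fun a => tag a == i)) //=.
  rewrite -(sum_component i (fun a => \sum_(b | crosses v a b) F a b)).
  apply: eq_bigr => a /eqP ai; rewrite -sum_strand.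
  apply: eq_big => [f|f /andP[_ /eqP ->] //].
  by apply: andb_idl => /eqP ->; rewrite ai.
have [K along total0] := mid_edge_along (vertex_generic D) i.
exists K; last first.
  by rewrite (sumE (fun a b => sgz (det2 (direction v a) (direction v b)))).
move=> e ei; pose sg a b := sgz (det2 (direction v a) (direction v b)).
rewrite (sumE (fun a b => sg a b *
  (1 + sgz (position e - ((tagged a : nat)%:R + crossing_time v a b))))) /=.
have := winding_inner (vertex_generic D) (strand e) (crossing_at01 e).
rewrite -/(double_point e).
have : position e = (tagged (strand e) : nat)%:R + crossing_at e by [].
have := crossing_at01 e; move: (position e) (crossing_at e) (winding v _).
case: (strand e) ei => [j k] /= ji; subst j => P t w /andP[t0 t1] PE wE.
pose A (m : 'I_(nv D i)) : edge D := Tagged (fun i => 'I_(nv D i)) m.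
pose a := A k; rewrite -[existT _ i k]/a in wE.
(* Edges before that of [e] count in full, later ones not at all, and the edge of [e] up to the time
   [t]. *)
have inner m : \sum_(b | crosses v (A m) b) sg (A m) b *
      (1 + sgz (P - ((m : nat)%:R + crossing_time v (A m) b))) =
    (if (m < k)%N then 2 * crossing_total v (A m) else 0) +
    (if m == k then crossing_total v a + crossing_sum v a t else 0).
  case: (ltngtP m k) => [mk|mk|/val_inj mk].
  - rewrite -val_eqE (ltn_eqF mk) addr0 mulr_sumr; apply: eq_bigr => b ab.
    rewrite gtr0_sgz; first by rewrite mulrC.
    have /andP[_ b1] := crosses_time ab.
    by move: mk; rewrite PE -(ler_nat R) -natr1; lra.
  - rewrite -val_eqE (gtn_eqF mk) addr0 big1 // => b ab.
    rewrite ltr0_sgz; first by rewrite subrr mulr0.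
    have /andP[b0 _] := crosses_time ab.
    by move: mk; rewrite PE -(ler_nat R) -natr1; lra.
  - rewrite mk eqxx add0r -big_split /=; apply: eq_bigr => b ab.
    by rewrite mulrDr mulr1 PE opprD addrACA subrr add0r.
have along_k : mid_edge v a + crossing_total v a =
  K - 2 * \sum_(m < nv D i | (m < k)%N) crossing_total v (A m) := along k.
transitivity (K - (2 * (\sum_(m < nv D i | (m < k)%N) crossing_total v (A m))
                   + (crossing_total v a + crossing_sum v a t))); first by lia.
rewrite (eq_bigr _ (fun m _ => inner m)) big_split /= -big_mkcond.
by rewrite -big_mkcond /= big_pred1_eq mulr_sumr.
Qed.
End DiagramWinding.

(** * Labels *)

Section Labels.
Variables (G : gauss_diagram) (lab : labeling G).
Implicit Types (i : bool) (k : int) (e f : arrow G * bool).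

Lemma lies_overP i k e : lies_over i k e ->
  exists2 r : nat, (k %% (size (circle G i))%:Z)%Z = r &
    (r < size (circle G i))%N /\ nth e (circle G i) r = e.
Proof.
rewrite /lies_over; set s := circle G i => /eqP ke.
have s0 : (0 < size s)%N by case: s ke => //; rewrite onthE /= nth_nil.
have n0 : 0 < (size s)%:Z by [].
have := modz_ge0 k (lt0r_neq0 n0); have := ltz_pmod k n0.
move: ke; case: (k %% _)%Z => //= r ke rs _; exists r => //; split=> //.
by move: ke; rewrite onthE (nth_map e) // => -[].
Qed.

Lemma lies_over_nth i (r : nat) e : (r < size (circle G i))%N ->
  lies_over i r (nth e (circle G i) r).
Proof.
by move=> rs; rewrite /lies_over modz_small //= onthE (nth_map e).
Qed.

Lemma label_take i (r : nat) : (r <= size (circle G i))%N ->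
  lab i r = lab i 0 + \sum_(e <- take r (circle G i)) jump e.
Proof.
elim: r => [|r IHr] rs; first by rewrite take0 big_nil addr0.
have [e _] : exists e, true by case: (circle G i) rs => // e *; exists e.
rewrite (take_nth e rs) -cats1 big_cat big_seq1 /= addrA -IHr ?(ltnW rs) //.
by rewrite -(labelP lab (lies_over_nth e rs)) -addn1.
Qed.

(** With total jump 0 the integer labels descend from the universal cover to the circle. *)
Lemma label_modz i k : \sum_(e <- circle G i) jump e = 0 ->
  (0 < size (circle G i))%N ->
  lab i k = lab i (k %% (size (circle G i))%:Z)%Z.
Proof.
set s := circle G i => jump0 s0; set n := (size s)%:Z.
have [e0 _] : exists e, e \in s.
  by case: (s) s0 => // e t _; exists e; exact: mem_head.
have period : lab i n = lab i 0.
  by rewrite label_take // take_size jump0 addr0.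
(* The defect of periodicity: [l] and its residue lie over the same endpoint, so [g] is constant,
   and it vanishes at 0. At the wrap-around this uses [period]. *)
pose g l := lab i l - lab i (l %% n)%Z.
have gS l : g (l + 1) = g l.
  have n0 : 0 < n by [].
  have := modz_ge0 l (lt0r_neq0 n0); have := ltz_pmod l n0.
  case lr : (l %% n)%Z => [r|//] rs _.
  have lo : lies_over i l (nth e0 s r).
    by rewrite /lies_over -/s -/n lr /= onthE (nth_map e0).
  have ro : lies_over i r (nth e0 s r) by exact: lies_over_nth.
  have lS : lab i ((l + 1) %% n)%Z = lab i (r%:Z + 1).
    rewrite -modzDml lr; case: (ltngtP r.+1 (size s)) => [lt|gt|eq].
    - by rewrite modz_small // -PoszD addn1.
    - by move: rs; rewrite /n ltz_nat; lia.
    - by rewrite -PoszD addn1 eq modzz period.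
  by rewrite /g lS (labelP lab lo) (labelP lab ro) lr; lia.
have g0 l : g l = 0.
  have g00 : g 0 = 0 by rewrite /g mod0z subrr.
  elim/int_ind: l => [//|m IH|m IH].
  - by rewrite -addn1 PoszD gS.
  - by rewrite -gS -addn1 PoszD opprD subrK.
by have /eqP := g0 k; rewrite subr_eq0 => /eqP.
Qed.
End Labels.

(** * Labels and winding numbers on a classical diagram *)

Section DiagramLabels.
Variables (R : realType) (D : virtual_diagram R).
Hypothesis D_classical : classical D.
Variable lab : labeling (gauss_of D).
Implicit Types (e f : classical_crossing D * bool).
Notation v := (@vertex R D).

Lemma mem_strand_circle i e : (e \in strand_circle D i) = (tag (strand e) == i).
Proof. by rewrite mem_sort mem_filter mem_enum andbT. Qed.

Lemma uniq_strand_circle i : uniq (strand_circle D i).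
Proof. by rewrite sort_uniq filter_uniq ?enum_uniq. Qed.

Lemma sum_strand_circle i (F : classical_crossing D * bool -> int) :
  \sum_(e <- strand_circle D i) F e = \sum_(e | tag (strand e) == i) F e.
Proof.
rewrite (perm_big _ (permEl (perm_sort _ _))) big_filter.
by rewrite big_enum_cond.
Qed.

Lemma componentE e : component (e : arrow (gauss_of D) * bool) = tag (strand e).
Proof. by rewrite /component mem_strand_circle; case: (tag _). Qed.

(** Since the circle is sorted by position and positions are distinct, the weights are 2 before [e],
    1 at [e] and 0 after it. *)
Lemma sum_take_strand_circle i e (r : nat) : (r < size (strand_circle D i))%N ->
  nth e (strand_circle D i) r = e ->
  \sum_(f <- strand_circle D i)
     crossing_sign_at f * (1 + sgz (position e - position f)) =
  2 * \sum_(f <- take r (strand_circle D i)) crossing_sign_at f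
  + crossing_sign_at e.
Proof.
have := uniq_strand_circle i; have := mem_strand_circle i.
have : pairwise (fun e f => position e <= position f) (strand_circle D i).
  rewrite -sorted_pairwise; first by apply: sort_sorted => x y; exact: le_total.
  by move=> x y z; exact: le_trans.
move: (strand_circle D i) => s; move=> sP s_mem s_uniq rs er.
have sE : s = take r s ++ e :: drop r.+1 s.
  by rewrite -[LHS](cat_take_drop r) (drop_nth e) // er.
have te : tag (strand e) == i by rewrite -s_mem -er mem_nth.
have lt_of x y : x \in s -> y \in s -> x != y -> position x <= position y ->
    position x < position y.
  rewrite !s_mem => /eqP xi /eqP yi xy; rewrite le_eqVlt => /predU1P[|//].
  by move/(position_inj (etrans xi (esym yi))) => E; rewrite E eqxx in xy.
move: sP s_uniq; rewrite [in X in X -> _]sE [in X in _ -> X -> _]sE.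
rewrite pairwise_cat cat_uniq /= => /and3P[lr _ /andP[er' _]].
move=> /and3P[_]; rewrite negb_or => /andP[el _] /andP[edr _].
rewrite [in LHS]sE big_cat big_cons /= subrr sgz0 addr0 mulr1.
rewrite [X in _ + (_ + X)]big_seq [X in _ + (_ + X)]big1 ?addr0; last first.
  move=> f fr; rewrite ltr0_sgz ?subrr ?mulr0 // subr_lt0.
  apply: lt_of; rewrite ?s_mem ?te //.
  - by rewrite -s_mem (mem_drop fr).
  - by apply: contraNneq edr => ->.
  - by move/allP: er'; apply.
congr (_ + _); rewrite mulr_sumr !big_seq; apply: eq_bigr => f fl.
rewrite gtr0_sgz; first by rewrite mulrC.
rewrite subr_gt0; apply: lt_of; rewrite ?s_mem ?te //.
- by rewrite -s_mem (mem_take fl).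
- by apply: contraNneq el => <-.
- by move/allrelP: lr; apply => //; rewrite mem_head.
Qed.

(** The labels around an endpoint add up to [2 * lab i 0] plus twice the earlier jumps plus its own
    jump, and these jumps are exactly what [winding] has lost from [K]. *)
Lemma label_winding i : exists C : int, forall k e,
  lies_over (G := gauss_of D) i k e ->
  lab i k + lab i (k + 1) = C - winding v (double_point e).
Proof.
have [K windE total0] := winding_double_point D_classical i.
exists (2 * lab i 0 + K) => k e ke; rewrite (labelP lab ke).
have [r kr [rs er]] := lies_overP ke.
have jump0 : \sum_(f <- circle (gauss_of D) i) jump f = 0.
  by rewrite (eq_bigr _ (fun f _ => jumpE f)) sum_strand_circle.
rewrite (label_modz lab k jump0 (leq_ltn_trans (leq0n r) rs)) kr.
rewrite (label_take lab (ltnW rs)) jumpE.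
have ei : tag (strand e) = i.
  by apply/eqP; rewrite -mem_strand_circle -er mem_nth.
rewrite windE // -sum_strand_circle (sum_take_strand_circle rs er).
set S := \sum_(f <- take r (circle _ i)) _; set S' := \sum_(f <- take r _) _.
have -> : S = S' by apply: eq_bigr => f _; exact: jumpE.
by move: (lab i 0) (S') (crossing_sign_at e) => x y z; lia.
Qed.

Lemma sum_jump_component i : \sum_(e | component e == i)
  jump (e : arrow (gauss_of D) * bool) = 0.
Proof.
have [_ _ total0] := winding_double_point D_classical i; rewrite -[RHS]total0.
by apply: eq_big => e; [rewrite componentE | rewrite jumpE].
Qed.
End DiagramLabels.

(** * The linking polynomial *)

Lemma gring_mulU (A : zmodType) (x y : int) (a b : A) :
  gring_mul << x *g a >> << y *g b >> = << x * y *g a + b >>.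
Proof.
rewrite /gring_mul !msuppU; have [->|x0] := eqVneq x 0.
  by rewrite big_seq_fset0 mul0r monalgU0.
rewrite big_seq_fset1; have [->|y0] := eqVneq y 0.
  by rewrite big_seq_fset0 mulr0 monalgU0.
by rewrite big_seq_fset1 !mcoeffUU.
Qed.

Lemma Zmod_classD n (x y : int) :
  Zmod_class n x + Zmod_class n y = Zmod_class n (x + y).
Proof. by rewrite /Zmod_class [RHS]pi_addr. Qed.

Lemma Zmod_class0 n : Zmod_class n 0 = 0.
Proof. by apply: (addIr (Zmod_class n 0)); rewrite Zmod_classD !add0r. Qed.

Section LinkingPolynomial.
Variable G : gauss_diagram.
Implicit Types (i j : bool) (c : arrow G).

(** The two endpoints of a self-arrow cancel; an arrow leaving [K1] contributes its sign, and one
    arriving contributes the opposite. *)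
Lemma directed_signs_balanced :
  \sum_(e | component e == K1) jump (e : arrow G * bool) = 0 ->
  \sum_(c : arrow G | directed K1 K2 c) sign c =
  \sum_(c : arrow G | directed K2 K1 c) sign c.
Proof.
rewrite big_mkcond /= => jump0; apply/eqP; rewrite -subr_eq0; apply/eqP.
rewrite -[RHS]jump0.
rewrite (eq_bigr (fun p => (fun c s => if component (c, s) == K1 then
  jump (c, s) else 0) p.1 p.2)); last by case.
rewrite -(pair_bigA _ (fun c s =>
  if component (c, s) == K1 then jump (c, s) else 0)).
rewrite [X in X - _]big_mkcond [X in _ - X]big_mkcond -sumrB /=.
apply: eq_bigr => c _; rewrite big_bool /= /directed /jump /tail_of /head_of /=.
by case: (component (c, true)) (component (c, false)) => [] [];
  rewrite /K1 /K2 /= ?subrr ?subr0 ?sub0r ?add0r ?addr0.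
Qed.

Lemma linking_numberE : linking_number G =
  2^-1 * (\sum_(c : arrow G | directed K1 K2 c) sign c
          + \sum_(c : arrow G | directed K2 K1 c) sign c)%:~R.
Proof.
rewrite /linking_number; congr (_ * _).
rewrite rmorphD /= !rmorph_sum /= [LHS]big_mkcond [X in X + _]big_mkcond.
rewrite [X in _ + X]big_mkcond -big_split /=; apply: eq_bigr => c _.
rewrite /directed.
by case: (component (tail_of c)) (component (head_of c)) => [] [];
  rewrite /K1 /K2 /= ?add0r ?addr0.
Qed.

Lemma arrow_sum_const (lab : labeling G) (p : endpoint_lifts G) i j a :
  (forall c : arrow G, directed i j c -> N lab p c = a) ->
  arrow_sum lab p i j = << \sum_(c : arrow G | directed i j c) sign c *g a >>.
Proof.
move=> Na; rewrite /arrow_sum raddf_sum; apply: eq_bigr => c /Na ->.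
by [].
Qed.
End LinkingPolynomial.

Theorem proposition5p6 (R : realType) (L : virtual_diagram R)
    (L_classical : classical L)
    (lab : labeling (gauss_of L)) (p : endpoint_lifts (gauss_of L)) :
  exists2 lk : int, lk%:~R = linking_number (gauss_of L)
    & linking_polynomial lab p = << lk ^+ 2 *g 0%R >>.
Proof.
have balanced := directed_signs_balanced (sum_jump_component L_classical K1).
have [C1 labC1] := label_winding L_classical lab K1.
have [C2 labC2] := label_winding L_classical lab K2.
pose C (i : bool) := if i then C2 else C1.
have labC i k (e : classical_crossing L * bool) :
    lies_over (G := gauss_of L) i k e ->
    lab i k + lab i (k + 1) = C i - winding (@vertex R L) (double_point e).
  by case: i; [exact: labC2 | exact: labC1].
pose d (c : arrow (gauss_of L)) : int :=
  lab (component (head_of c)) (p (head_of c))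
  - lab (component (tail_of c)) (p (tail_of c) + 1).
(* The label before the head and the label after the tail both exceed the mean of the labels around
   their endpoint by half the sign. So [d c] is the difference of the means, and the common winding
   number drops out. *)
have twice_d i j (c : arrow (gauss_of L)) :
    directed i j c -> 2 * d c = C j - C i.
  case/andP=> /eqP ti /eqP hj.
  have tl := lift_posP p (tail_of c); have hl := lift_posP p (head_of c).
  have := labC _ _ _ tl; have := labC _ _ _ hl; rewrite double_point_tail_head.
  rewrite /d (labelP lab tl) (labelP lab hl) ti hj /jump /=.
  move: (lab i _) (lab j _) (C i) (C j) (winding _ _) (sign c).
  by move=> x y z t u w; lia.
(* [C2 - C1] is known to be even only if some arrow joins the circles, so [m] is read off such an
   arrow; without one any value serves. *)
have [m [m12 m21]] : exists m : int,
    (forall c : arrow (gauss_of L), directed K1 K2 c -> d c = m) /\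
    (forall c : arrow (gauss_of L), directed K2 K1 c -> d c = - m).
  have [c0 /twice_d d0|no12] := pickP (directed (G := gauss_of L) K1 K2).
    by exists (d c0); split=> c /twice_d; lia.
  have [c0 /twice_d d0|no21] := pickP (directed (G := gauss_of L) K2 K1).
    by exists (- d c0); split=> c; [rewrite no12 | move/twice_d; lia].
  by exists 0; split=> c; rewrite ?no12 ?no21.
(* By balance, half the sum over both directions is the integer sum over one of them. *)
exists (\sum_(c : arrow (gauss_of L) | directed K1 K2 c) sign c).
  by rewrite linking_numberE -balanced rmorphD /=; lra.
rewrite /linking_polynomial.
rewrite (arrow_sum_const (a := Zmod_class _ m)); last by move=> c /m12 <-.
rewrite (arrow_sum_const (a := Zmod_class _ (- m))); last by move=> c /m21 <-.
by rewrite gring_mulU -balanced Zmod_classD subrr expr2 Zmod_class0.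
Qed.
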